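(* Let $G$ be a finite group, $K\le G$ a subgroup, $(\sigma,W)$ a representation of $G$ and $(\theta,V)$ a representation of $K$. (1) For each $T\in \mathrm{Hom}_G(W,\mathrm{Ind}_K^GV)$ we have $T^\wedge\in \mathrm{Hom}_K(\mathrm{Res}^G_KW,V)$, and the map $$\mathrm{Hom}_G(W,\mathrm{Ind}_K^GV)\longrightarrow \mathrm{Hom}_K(\mathrm{Res}^G_KW,V),\qquad T\longmapsto T^\wedge,$$ is a linear isometric isomorphism. Moreover, its inverse is the map $\mathrm{Hom}_K(\mathrm{Res}^G_KW,V)\to\mathrm{Hom}_G(W,\mathrm{Ind}_K^GV)$, $L\mapsto L^\vee$. (2) For each $T\in \mathrm{Hom}_G(W,\mathrm{Ind}_K^GV)$ we have $$(T^* )^\circ=(T^\wedge)^*.$$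
   Context: All vector spaces are finite-dimensional complex vector spaces with a Hermitian scalar product (linear in the first argument); all representations of finite groups are unitary. $T^*$ denotes the adjoint of $T$. For spaces $A,B$, $\mathrm{Hom}(A,B)$ (and every subspace of it) carries the normalized Hilbert–Schmidt scalar product $\langle T_1,T_2\rangle=\frac{1}{\dim A}\mathrm{tr}(T_2^*T_1)$; ''isometric'' refers to these scalar products. $\mathrm{Hom}_G(A,B)$ (resp. $\mathrm{Hom}_K$) is the space of linear maps intertwining the $G$- (resp. $K$-) actions. Induced representation: $\mathrm{Ind}_K^GV=\{f:G\to V: f(gk)=\theta(k^{-1})f(g)\ \forall g\in G,k\in K\}$ with $G$-action $[\lambda(g_0)f](g)=f(g_0^{-1}g)$ and scalar product $\langle f_1,f_2\rangle=\frac1{|K|}\sum_{g\in G}\langle f_1(g),f_2(g)\rangle_V$. For $v\in V$, $f_v\in \mathrm{Ind}_K^GV$ is defined by $f_v(g)=\theta(g^{-1})v$ if $g\in K$ and $f_v(g)=0$ if $g\notin K$. Maps: for $T\in\mathrm{Hom}_G(W,\mathrm{Ind}_K^GV)$, $T^\wedge w=\sqrt{|G/K|}\,[Tw](1_G)$ ($w\in W$). For $L\in\mathrm{Hom}_K(\mathrm{Res}^G_KW,V)$, $[L^\vee w](g)=\frac{1}{\sqrt{|G/K|}}L\sigma(g^{-1})w$ ($w\in W,g\in G$). For $S\in\mathrm{Hom}_G(\mathrm{Ind}_K^GV,W)$, $S^\circ v=\sqrt{|G/K|}\,Sf_v$ ($v\in V$). If $T\in\mathrm{Hom}_G(W,\mathrm{Ind}_K^GV)$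 then $T^*\in\mathrm{Hom}_G(\mathrm{Ind}_K^GV,W)$. *)

(* Defs.v *)
From HB Require Import structures.
From mathcomp Require Import all_boot all_order all_fingroup all_algebra.
From mathcomp Require Export sesquilinear.

Set Implicit Arguments.
Unset Strict Implicit.
Unset Printing Implicit Defensive.

Import GRing.Theory Num.Theory Num.Def.
Local Open Scope ring_scope.

(* A finite-dimensional Hermitian space is a vectType A over C together with  *)
(* a form dA : {dot A for conjC}, which is linear in its first argument.      *)

Section Hermitian.
Variable C : numClosedFieldType.

Lemma linfunE (A B : vectType C) (f : A -> B) : linear f -> linfun f =1 f.
Proof.
move=> lin a.
pose F := GRing.isSemilinear.Build C A B _ f (GRing.semilinear_linear lin).
pose g : {linear A -> B} := HB.pack f F.
exact: (lfunE g).
Qed.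

Section Adjoint.
Variables (A B : vectType C) (dA : {dot A for conjC}) (dB : {dot B for conjC}).

Let n := \dim {:A}.
Let e := vbasis {:A}.

(* The coordinates [<a, e_i>]_i determine a since dA is positive definite.    *)
Definition pairing (a : A) : 'rV[C]_n := \row_i dA a e`_i.

Lemma pairing_is_linear : linear pairing.
Proof. by move=> c a b; apply/rowP=> i; rewrite !mxE linearPl. Qed.

HB.instance Definition _ :=
  GRing.isSemilinear.Build C A 'rV[C]_n _ pairing
    (GRing.semilinear_linear pairing_is_linear).

(* T^* b is the vector a such that <a, e_i> = <b, T e_i> for all i.           *)
Definition copairing (T : 'Hom(A, B)) (b : B) : 'rV[C]_n :=
  \row_i dB b (T e`_i).

Lemma copairing_is_linear T : linear (copairing T).
Proof. by move=> c a b; apply/rowP=> i; rewrite !mxE linearPl. Qed.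

HB.instance Definition _ T :=
  GRing.isSemilinear.Build C B 'rV[C]_n _ (copairing T)
    (GRing.semilinear_linear (copairing_is_linear T)).

Definition adjoint (T : 'Hom(A, B)) : 'Hom(B, A) :=
  ((linfun pairing)^-1 \o linfun (copairing T))%VF.

Lemma dot_conj (U : vectType C) (d : {dot U for conjC}) u v :
  d u v = (d v u)^*.
Proof. by rewrite hermC expr0 mul1r. Qed.

Lemma dot_inj (U : vectType C) (d : {dot U for conjC}) u v :
  (forall x, d u x = d v x) -> u = v.
Proof.
move=> H; apply/eqP; rewrite -subr_eq0 -(dnorm_eq0 d).
by rewrite linearBl /= H subrr.
Qed.

Lemma pairing_inj : injective (linfun pairing).
Proof.
move=> a b; rewrite !lfunE /= => /rowP eq_ab; apply: (@dot_inj _ dA) => x.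
rewrite (coord_vbasis (memvf x)) !linear_sumr; apply: eq_bigr => i _.
by rewrite !linearZr_LR /=; have := eq_ab i; rewrite !mxE => ->.
Qed.

Lemma limg_pairing : limg (linfun pairing) = fullv.
Proof.
have inj0 : (fullv :&: lker (linfun pairing) = 0)%VS.
  by move/lker0P: pairing_inj => /eqP->; rewrite capv0.
apply/eqP; rewrite eqEdim subvf limg_dim_eq //=.
have -> : \dim {:'rV[C]_n} = (1 * n)%N by rewrite dimvf.
by rewrite mul1n.
Qed.

Lemma adjointP (T : 'Hom(A, B)) a b : dA a (adjoint T b) = dB (T a) b.
Proof.
have /rowP H : linfun pairing (adjoint T b) = copairing T b.
  by rewrite comp_lfunE limg_lfunVK ?limg_pairing ?memvf // lfunE.
rewrite (coord_vbasis (memvf a)) linear_sum linear_sumlz linear_sumlz.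
apply: eq_bigr => i _; rewrite linearZ !linearZl_LR; congr (_ * _).
have := H i; rewrite lfunE !mxE => Hi.
by rewrite [LHS]dot_conj Hi -dot_conj.
Qed.

Lemma adjoint_unique (T : 'Hom(A, B)) (S : 'Hom(B, A)) :
  (forall a b, dB (T a) b = dA a (S b)) -> S = adjoint T.
Proof.
move=> H; apply/lfunP=> b; apply: (@dot_inj _ dA) => a.
by rewrite dot_conj -H -adjointP -dot_conj.
Qed.

End Adjoint.

Definition ltrace (A : vectType C) (f : 'End(A)) : C :=
  \sum_i coord (vbasis {:A}) i (f (vbasis {:A})`_i).

(* The normalized Hilbert-Schmidt product; if A = 0 it is 0, as is Hom(A, B). *)
Definition hs_dot (A B : vectType C)
    (dA : {dot A for conjC}) (dB : {dot B for conjC})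
    (T1 T2 : 'Hom(A, B)) : C :=
  (\dim {:A})%:R^-1 * ltrace (adjoint dA dB T2 \o T1)%VF.

End Hermitian.

Section Representations.
Variables (C : numClosedFieldType) (gT : finGroupType).

(* A unitary representation of H; its values outside H are irrelevant.        *)
Record unitary_rep (H : {group gT}) (A : vectType C) (dA : {dot A for conjC}) :=
  UnitaryRep {
    rep_fun :> gT -> 'End(A);
    rep1 : rep_fun 1%g = \1%VF;
    repM : {in H &, forall g h, rep_fun (g * h)%g = (rep_fun g \o rep_fun h)%VF};
    rep_unitary : {in H, forall g a b, dA (rep_fun g a) (rep_fun g b) = dA a b}
  }.

Definition res_rep (H K : {group gT}) (sKH : K \subset H)
    (A : vectType C) (dA : {dot A for conjC}) (rho : unitary_rep H dA) :
    unitary_rep K dA :=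
  @UnitaryRep K A dA rho (rep1 rho) (sub_in2 (subsetP sKH) (@repM _ _ _ rho))
    (sub_in1 (subsetP sKH) (@rep_unitary _ _ _ rho)).

Section HomSpace.
Variables (H : {group gT}) (A B : vectType C).
Variables (dA : {dot A for conjC}) (dB : {dot B for conjC}).
Variables (rA : unitary_rep H dA) (rB : unitary_rep H dB).

Definition commutator_map g (T : 'Hom(A, B)) : 'Hom(A, B) :=
  ((T \o rA g) - (rB g \o T))%VF.

Lemma commutator_map_is_linear g : linear (commutator_map g).
Proof.
move=> c T S; rewrite /commutator_map comp_lfunDl comp_lfunDr.
by rewrite -comp_lfunZl -comp_lfunZr scalerBr opprD addrACA.
Qed.

HB.instance Definition _ g :=
  GRing.isSemilinear.Build C 'Hom(A, B) 'Hom(A, B) _ (commutator_map g)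
    (GRing.semilinear_linear (commutator_map_is_linear g)).

Definition hom_rep : {vspace 'Hom(A, B)} :=
  (\bigcap_(g in H) lker (linfun (commutator_map g)))%VS.

Lemma hom_repP T :
  reflect {in H, forall g, (T \o rA g = rB g \o T)%VF} (T \in hom_rep).
Proof.
rewrite memvE; apply: (iffP subv_bigcapP) => HT g gH.
  apply/eqP; rewrite -subr_eq0; have := HT g gH.
  by rewrite -memvE memv_ker lfunE.
by rewrite -memvE memv_ker lfunE /= /commutator_map HT ?subrr.
Qed.

End HomSpace.

Lemma rep_adj (H : {group gT}) (A : vectType C) (dA : {dot A for conjC})
    (rA : unitary_rep H dA) g a b :
  g \in H -> dA (rA g a) b = dA a (rA g^-1%g b).
Proof.
move=> gH; rewrite -(rep_unitary rA (groupVr gH)) -comp_lfunE.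
by rewrite -repM ?groupV // mulVg rep1 id_lfunE.
Qed.

Lemma adjoint_hom_rep (H : {group gT}) (A B : vectType C)
    (dA : {dot A for conjC}) (dB : {dot B for conjC})
    (rA : unitary_rep H dA) (rB : unitary_rep H dB) T :
  T \in hom_rep rA rB -> adjoint dA dB T \in hom_rep rB rA.
Proof.
move=> /hom_repP HT; apply/hom_repP=> g gH.
have HTg x : T (rA g^-1%g x) = rB g^-1%g (T x).
  by have /lfunP/(_ x) := HT g^-1%g (groupVr gH); rewrite !comp_lfunE.
pose S := adjoint dA dB T.
have SE y x : dA (S y) x = dB y (T x).
  by rewrite [LHS]dot_conj [RHS]dot_conj /S adjointP.
rewrite -/S; move: S SE => S SE; apply/lfunP=> b.
rewrite !comp_lfunE; apply: (@dot_inj _ _ dA) => x.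
by rewrite SE (rep_adj rB _ _ gH) -HTg -SE -(rep_adj rA _ _ gH).
Qed.

End Representations.

Section Induction.
Variables (C : numClosedFieldType) (gT : finGroupType) (K : {group gT}).
Variables (V : vectType C) (dV : {dot V for conjC}) (theta : unitary_rep K dV).

Definition ind_defect g k (f : {ffun gT -> V}) : V :=
  f (g * k)%g - theta k^-1%g (f g).

Lemma ind_defect_is_linear g k : linear (ind_defect g k).
Proof.
by move=> c f1 f2; rewrite /ind_defect !ffunE linearP scalerBr opprD addrACA.
Qed.

HB.instance Definition _ g k :=
  GRing.isSemilinear.Build C {ffun gT -> V} V _ (ind_defect g k)
    (GRing.semilinear_linear (ind_defect_is_linear g k)).

Definition ind_space : {vspace {ffun gT -> V}} :=
  (\bigcap_g \bigcap_(k in K) lker (linfun (ind_defect g k)))%VS.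

Lemma ind_spaceP (f : {ffun gT -> V}) :
  reflect (forall g, {in K, forall k, f (g * k)%g = theta k^-1%g (f g)})
          (f \in ind_space).
Proof.
rewrite memvE; apply: (iffP subv_bigcapP) => Hf g.
  move=> k kK; apply/eqP; rewrite -subr_eq0.
  move/subv_bigcapP: (Hf g isT) => /(_ k kK).
  by rewrite -memvE memv_ker lfunE.
move=> _; apply/subv_bigcapP=> k kK.
by rewrite -memvE memv_ker lfunE /= /ind_defect Hf ?subrr.
Qed.

Definition ind_type := subvs_of ind_space.
HB.instance Definition _ := Vector.on ind_type.

Definition ind_dot (f1 f2 : ind_type) : C :=
  #|K|%:R^-1 * \sum_g dV (vsval f1 g) (vsval f2 g).

Lemma ind_dot_is_bilinear :
  bilinear_for (GRing.Scale.Law.clone _ _ *%R _)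
    (GRing.Scale.Law.clone _ _ (conjC \; *%R) _) ind_dot.
Proof.
split=> [f2|f1] c x y /=; rewrite /ind_dot mulrCA -mulrDr.
  congr (_ * _); rewrite mulr_sumr -big_split; apply: eq_bigr => g _ /=.
  by rewrite !ffunE linearPl.
congr (_ * _); rewrite mulr_sumr -big_split; apply: eq_bigr => g _ /=.
by rewrite !ffunE linearPr.
Qed.

HB.instance Definition _ :=
  bilinear_isBilinear.Build C ind_type ind_type C _ _ ind_dot
    ind_dot_is_bilinear.

Lemma ind_dot_is_hermitian f1 f2 :
  ind_dot f1 f2 = (-1) ^+ false * (ind_dot f2 f1)^*.
Proof.
rewrite mul1r /ind_dot rmorphM fmorphV rmorph_nat rmorph_sum.
by congr (_ * _); apply: eq_bigr => g _; apply: dot_conj.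
Qed.

HB.instance Definition _ :=
  isHermitianSesquilinear.Build C ind_type false conjC ind_dot
    ind_dot_is_hermitian.

Lemma ind_dot_gt0 f : f != 0 -> 0 < ind_dot f f.
Proof.
move=> f_neq0; rewrite /ind_dot mulr_gt0 ?invr_gt0 ?ltr0n ?cardG_gt0 //.
rewrite lt0r sumr_ge0 => [|g _]; last exact: dnorm_ge0.
rewrite andbT psumr_eq0 => [|g _]; last exact: dnorm_ge0.
apply: contra f_neq0 => /allP f0; apply/eqP/val_inj/ffunP=> g.
by rewrite ffunE; apply/eqP; rewrite -(dnorm_eq0 dV); exact: f0 g (mem_index_enum g).
Qed.

HB.instance Definition _ := isDotProduct.Build C ind_type ind_dot ind_dot_gt0.

(* ind_elt f is f, seen in Ind_K^G V, when f satisfies the covariance         *)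
(* condition (ind_eltE); elsewhere it is a projection and is never used.      *)
Definition ind_elt (f : {ffun gT -> V}) : ind_type := vsproj ind_space f.

Lemma ind_eltE f : f \in ind_space -> vsval (ind_elt f) = f.
Proof. exact: vsprojK. Qed.

Definition translate (g0 : gT) (f : ind_type) : ind_type :=
  ind_elt [ffun g => vsval f (g0^-1 * g)%g].

Lemma translateE g0 f g : vsval (translate g0 f) g = vsval f (g0^-1 * g)%g.
Proof.
rewrite ind_eltE ?ffunE //; apply/ind_spaceP=> x k kK; rewrite !ffunE mulgA.
by have /ind_spaceP-> := subvsP f.
Qed.

Lemma translate_is_linear g0 : linear (translate g0).
Proof.
by move=> c f1 f2; apply/val_inj/ffunP=> g; rewrite !(translateE, ffunE).
Qed.

HB.instance Definition _ g0 :=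
  GRing.isSemilinear.Build C ind_type ind_type _ (translate g0)
    (GRing.semilinear_linear (translate_is_linear g0)).

Lemma ind_rep1 : linfun (translate 1) = \1%VF.
Proof.
apply/lfunP=> f; apply/val_inj/ffunP=> g.
by rewrite !lfunE /= translateE invg1 mul1g.
Qed.

Lemma ind_repM : {in [set: gT] &, forall g h,
  linfun (translate (g * h)) = (linfun (translate g) \o linfun (translate h))%VF}.
Proof.
move=> g h _ _; apply/lfunP=> f; apply/val_inj/ffunP=> x.
by rewrite comp_lfunE !lfunE /= !translateE invMg mulgA.
Qed.

Lemma ind_rep_unitary : {in [set: gT], forall g f1 f2,
  ind_dot (linfun (translate g) f1) (linfun (translate g) f2) = ind_dot f1 f2}.
Proof.
move=> g _ f1 f2; rewrite /ind_dot; congr (_ * _).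
rewrite (reindex_inj (mulgI g)); apply: eq_bigr => x _.
by rewrite !lfunE !translateE mulKg.
Qed.

Definition ind_rep : unitary_rep [set: gT] ind_dot :=
  UnitaryRep ind_rep1 ind_repM ind_rep_unitary.

(* The function f_v, supported on K.                                          *)
Definition ind_vec (v : V) : ind_type :=
  ind_elt [ffun g => if g \in K then theta g^-1%g v else 0].

Lemma ind_vecE v g :
  vsval (ind_vec v) g = if g \in K then theta g^-1%g v else 0.
Proof.
rewrite ind_eltE ?ffunE //; apply/ind_spaceP=> x k kK; rewrite !ffunE.
rewrite groupMr //; case: ifP => xK; last by rewrite linear0.
by rewrite invMg repM ?groupV // comp_lfunE.
Qed.

Lemma ind_vec_is_linear : linear ind_vec.
Proof.
move=> c u v; apply/val_inj/ffunP=> g; rewrite !(ind_vecE, ffunE) /=.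
by case: ifP => _; rewrite ?linearP // scaler0 addr0.
Qed.

HB.instance Definition _ :=
  GRing.isSemilinear.Build C V ind_type _ ind_vec
    (GRing.semilinear_linear ind_vec_is_linear).

Variables (W : vectType C) (dW : {dot W for conjC}).
Variable sigma : unitary_rep [set: gT] dW.

Definition sqrt_index : C := sqrtC #|[set: gT] : K|%g%:R.

Definition wedge (T : 'Hom(W, ind_type)) : 'Hom(W, V) :=
  linfun (fun w => sqrt_index *: vsval (T w) 1%g).

Lemma wedgeE T w : wedge T w = sqrt_index *: vsval (T w) 1%g.
Proof.
rewrite linfunE // => c x y.
by rewrite !linearP !ffunE scalerDr !scalerA mulrC.
Qed.

(* The right-hand side is in Ind_K^G V only if L intertwines the actions of   *)
(* K; see veeE.                                                               *)
Definition vee (L : 'Hom(W, V)) : 'Hom(W, ind_type) :=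
  linfun (fun w => ind_elt [ffun g => sqrt_index^-1 *: L (sigma g^-1%g w)]).

Lemma veeE (L : 'Hom(W, V)) w g :
  L \in hom_rep (res_rep (subsetT K) sigma) theta ->
  vsval (vee L w) g = sqrt_index^-1 *: L (sigma g^-1%g w).
Proof.
move=> /hom_repP LK.
rewrite linfunE => [|c x y]; last first.
  rewrite /ind_elt -linearP; congr (vsproj _ _).
  by apply/ffunP=> h; rewrite !ffunE !linearP.
rewrite ind_eltE ?ffunE //.
apply/ind_spaceP=> x k kK; rewrite !ffunE linearZ /=; congr (_ *: _).
rewrite invMg repM ?inE // comp_lfunE.
by have /lfunP/(_ (sigma x^-1%g w)) := LK k^-1%g (groupVr kK); rewrite !lfunE.
Qed.

Definition circ (S : 'Hom(ind_type, W)) : 'Hom(V, W) :=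
  linfun (fun v => sqrt_index *: S (ind_vec v)).

Lemma circE S v : circ S v = sqrt_index *: S (ind_vec v).
Proof.
by rewrite linfunE // => c x y; rewrite !linearP.
Qed.

End Induction.

Arguments ind_dot {C gT K V dV} theta f1 f2.
Arguments wedge {C gT K V dV theta W} T.
Arguments circ {C gT K V dV theta W} S.

(* Main.v *)
(* The isometry is an averaging argument. Write Q f = f_(f(1)); then           *)
(* |K| id = \sum_g lambda(g) Q lambda(g)^-1 on Ind_K^G V, while by part (2)    *)
(* (T2^)^* T1^ = |G : K| T2^* Q T1. Conjugating by sigma(g) and using cyclicity *)
(* of the trace, tr(T2^* T1) = |G| / |K| tr(T2^* Q T1) = tr((T2^)^* T1^).       *)

Require Import Defs.
From mathcomp Require Import all_boot all_order all_fingroup all_algebra.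
From mathcomp Require Import reals complex.

Import Num.Def.
Local Open Scope ring_scope.
Local Open Scope complex_scope.

Import GRing.Theory Num.Theory.

Set Implicit Arguments.
Unset Strict Implicit.

(** Since (T w)(g) = (T (sigma(g^-1) w))(1), a G-map [T] into the induced space is determined by
    evaluation at 1. Rebuilding [T] from that evaluation is what [vee] does, and the two square
    roots of the index cancel ([wedgeK], [veeK]). Evaluation at 1 is represented by the vectors f_v,
    as <f, f_v> = <f(1), v> ([ind_dot_vec]); taking adjoints turns this into part (2),
    [circ_adjoint]. The isometry combines part (2) with [ind_center_average]: [ind_center] restricts
    a function to K, its conjugates restrict to the cosets gK, and together these cover every point
    |K| times. *)

Section Trace.
Variable C : numClosedFieldType.

Lemma ltraceC (A B : vectType C) (f : 'Hom(A, B)) (g : 'Hom(B, A)) :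
  ltrace (g \o f)%VF = ltrace (f \o g)%VF.
Proof.
(* This double sum is symmetric in the two maps, so expanding both sides leaves only an exchange of
   sums. *)
have expand (X Y : vectType C) (h : 'Hom(X, Y)) (k : 'Hom(Y, X)) :
    ltrace (k \o h)%VF = \sum_(i < \dim {:X}) \sum_(j < \dim {:Y})
      coord (vbasis {:Y}) j (h (vbasis {:X})`_i)
      * coord (vbasis {:X}) i (k (vbasis {:Y})`_j).
  apply: eq_bigr => i _; rewrite comp_lfunE.
  rewrite {1}(coord_vbasis (memvf (h (vbasis {:X})`_i))) !linear_sum.
  by apply: eq_bigr => j _; rewrite !linearZ.
rewrite !expand exchange_big.
by apply: eq_bigr => i _; apply: eq_bigr => j _; rewrite mulrC.
Qed.

Lemma ltrace_sum (A : vectType C) (I : finType) (F : I -> 'End(A)) :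
  ltrace (\sum_i F i) = \sum_i ltrace (F i).
Proof.
rewrite /ltrace exchange_big; apply: eq_bigr => i _.
by rewrite sum_lfunE linear_sum.
Qed.

Lemma ltraceZ (A : vectType C) (c : C) (f : 'End(A)) :
  ltrace (c *: f) = c * ltrace f.
Proof.
by rewrite /ltrace mulr_sumr; apply: eq_bigr => i _; rewrite lfunE linearZ.
Qed.

End Trace.

Section Frobenius.
Variables (C : numClosedFieldType) (gT : finGroupType) (K : {group gT}).
Variables (W : vectType C) (dW : {dot W for conjC}).
Variable sigma : unitary_rep [set: gT] dW.
Variables (V : vectType C) (dV : {dot V for conjC}) (theta : unitary_rep K dV).

Local Notation HomG := (hom_rep sigma (ind_rep theta)).
Local Notation HomK := (hom_rep (res_rep (subsetT K) sigma) theta).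
Local Notation s := (sqrt_index C K).

Lemma sqrt_index_ge0 : 0 <= s.
Proof. by rewrite sqrtC_ge0 ler0n. Qed.

Lemma sqrt_index_neq0 : s != 0.
Proof. by rewrite sqrtC_eq0 pnatr_eq0 -lt0n indexg_gt0. Qed.

Lemma ind_eval_mul (f : ind_type theta) g k :
  k \in K -> vsval f (g * k)%g = theta k^-1%g (vsval f g).
Proof. by move=> kK; have /ind_spaceP-> := subvsP f. Qed.

Lemma ind_rep_eval (f : ind_type theta) g x :
  vsval (ind_rep theta g f) x = vsval f (g^-1 * x)%g.
Proof. by rewrite lfunE /= translateE. Qed.

Lemma hom_rep_eval {H : {group gT}} {A B : vectType C}
    {dA : {dot A for conjC}} {dB : {dot B for conjC}}
    {rA : unitary_rep H dA} {rB : unitary_rep H dB} {T} :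
  T \in hom_rep rA rB -> forall g a, g \in H -> T (rA g a) = rB g (T a).
Proof.
move=> /hom_repP HT g a gH.
by have /lfunP/(_ a) := HT g gH; rewrite !comp_lfunE.
Qed.

Lemma wedge_is_linear : linear (@wedge _ _ _ _ _ theta W).
Proof.
move=> a T1 T2; apply/lfunP=> w; rewrite add_lfunE scale_lfunE !wedgeE.
by rewrite add_lfunE scale_lfunE !ffunE scalerDr !scalerA mulrC.
Qed.

Lemma wedge_hom T : T \in HomG -> wedge T \in HomK.
Proof.
move=> TG; apply/hom_repP=> k kK; apply/lfunP=> w.
rewrite !comp_lfunE !wedgeE linearZ; congr (_ *: _).
rewrite (hom_rep_eval TG) ?inE // ind_rep_eval mulg1 -[k^-1%g]mul1g.
by rewrite ind_eval_mul ?groupV // invgK.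
Qed.

Lemma vee_hom L : L \in HomK -> vee theta sigma L \in HomG.
Proof.
move=> LK; apply/hom_repP=> g _; apply/lfunP=> w; rewrite !comp_lfunE.
apply/val_inj/ffunP=> x; rewrite ind_rep_eval !veeE //.
by rewrite invMg invgK repM ?inE // comp_lfunE.
Qed.

Lemma wedgeK : {in HomG, cancel wedge (vee theta sigma)}.
Proof.
move=> T TG; apply/lfunP=> w; apply/val_inj/ffunP=> g.
rewrite veeE ?wedge_hom // wedgeE scalerA mulVf ?sqrt_index_neq0 // scale1r.
by rewrite (hom_rep_eval TG) ?inE // ind_rep_eval invgK mulg1.
Qed.

Lemma veeK : {in HomK, cancel (vee theta sigma) wedge}.
Proof.
move=> L LK; apply/lfunP=> w; rewrite wedgeE veeE // scalerA.
by rewrite divff ?sqrt_index_neq0 // scale1r invg1 rep1 id_lfunE.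
Qed.

(** On K both functions are theta(g^-1) applied to their value at 1, so by unitarity all |K|
    surviving terms agree and the factor 1/|K| cancels. *)
Lemma ind_dot_vec (f : ind_type theta) v :
  ind_dot theta f (ind_vec theta v) = dV (vsval f 1%g) v.
Proof.
have K_neq0 : #|K|%:R != 0 :> C by rewrite pnatr_eq0 -lt0n cardG_gt0.
rewrite /ind_dot (bigID (mem K)) /= addrC big1 => [|g /negPf gK]; last first.
  by rewrite ind_vecE gK linear0r.
rewrite add0r (eq_bigr (fun=> dV (vsval f 1%g) v)) => [|g gK]; last first.
  rewrite ind_vecE gK -{1}[g]mul1g ind_eval_mul //.
  by rewrite rep_unitary ?groupV.
by rewrite sumr_const -[X in _ * X]mulr_natl mulKf.
Qed.

Lemma circ_adjoint T :
  circ (adjoint dW (ind_dot theta) T) = adjoint dW dV (wedge T).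
Proof.
apply: adjoint_unique => w v; rewrite wedgeE circE.
rewrite linearZl_LR linearZr_LR /= adjointP.
(* The scalar left the conjugate-linear slot conjugated; it is real. *)
rewrite (CrealP (ger0_real sqrt_index_ge0)); congr (_ * _).
exact/esym/ind_dot_vec.
Qed.

(** By covariance f_(f(1)) agrees with f on K and vanishes elsewhere, so this is the projection onto
    functions supported on K. *)
Definition ind_center : 'End(ind_type theta) :=
  linfun (fun f : ind_type theta => ind_vec theta (vsval f 1%g)).

Lemma ind_centerE f : ind_center f = ind_vec theta (vsval f 1%g).
Proof. by rewrite linfunE // => c x y; rewrite linearP !ffunE linearP. Qed.

Lemma ind_center_average :
  \sum_g (ind_rep theta g \o ind_center \o ind_rep theta g^-1%g)%VF
  = #|K|%:R *: \1%VF.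
Proof.
apply/lfunP=> f; apply/val_inj/ffunP=> x.
rewrite sum_lfunE linear_sum sum_ffunE !lfunE /= ffunE id_lfunE.
have term g : vsval ((ind_rep theta g \o ind_center
    \o ind_rep theta g^-1%g)%VF f) x
    = if (g^-1 * x)%g \in K then vsval f x else 0.
  rewrite !comp_lfunE ind_rep_eval ind_centerE ind_vecE ind_rep_eval.
  by case: ifP => // gK; rewrite invgK mulg1 -ind_eval_mul // mulKVg.
rewrite (eq_bigr _ (fun g _ => term g)) -big_mkcond sumr_const scaler_nat.
(* The g with x in gK are exactly the elements of xK. *)
congr (_ *+ _); rewrite -(card_lcoset K x); apply: eq_card => g.
by rewrite mem_lcoset -groupV invMg invgK.
Qed.

Lemma wedge_isometry : {in HomG &, forall T1 T2,
  hs_dot dW dV (wedge T1) (wedge T2) = hs_dot dW (ind_dot theta) T1 T2}.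
Proof.
move=> T1 T2 T1G T2G; rewrite /hs_dot -circ_adjoint; congr (_ * _).
have := adjoint_hom_rep T2G; move: (adjoint _ _ T2) => S SG.
have K_neq0 : #|K|%:R != 0 :> C by rewrite pnatr_eq0 -lt0n cardG_gt0.
have -> : (circ S \o wedge T1)%VF
    = #|[set: gT] : K|%g%:R *: (S \o ind_center \o T1)%VF.
  apply/lfunP=> w; rewrite scale_lfunE !comp_lfunE circE wedgeE 2!linearZ /=.
  by rewrite ind_centerE scalerA -expr2 sqrtCK.
(* By Lagrange this turns the index on the left into |G|, the number of terms of the average, and
   creates |K| id on the right. *)
apply: (mulfI K_neq0).
rewrite [in LHS]ltraceZ mulrA -natrM Lagrange ?subsetT //.
rewrite -[in RHS](comp_lfun1l T1) -[in RHS]ltraceZ comp_lfunZr comp_lfunZl.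
rewrite -ind_center_average.
(* Both [S] and [T1] intertwine, so the conjugation moves outside and becomes one by sigma(g),
   invisible to the trace. *)
have -> : (S \o ((\sum_g (ind_rep theta g \o ind_center
    \o ind_rep theta g^-1%g)%VF) \o T1))%VF
    = \sum_g (sigma g \o ((S \o ind_center \o T1) \o sigma g^-1%g))%VF.
  apply/lfunP=> w; rewrite sum_lfunE !comp_lfunE sum_lfunE linear_sum.
  apply: eq_bigr => g _; rewrite !comp_lfunE (hom_rep_eval T1G) ?inE //.
  exact: (hom_rep_eval SG _ (in_setT g)).
rewrite [RHS]ltrace_sum.
rewrite (eq_bigr (fun=> ltrace (S \o ind_center \o T1)%VF)) => [|g _].
  by rewrite sumr_const cardsT mulr_natl.
by rewrite ltraceC -comp_lfunA -repM ?inE // mulVg rep1 comp_lfun1r.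
Qed.

End Frobenius.

Theorem theorem3p2 (R : realType) (gT : finGroupType) (K : {group gT})
    (W : vectType R[i]) (dW : {dot W for conjC})
    (sigma : unitary_rep [set: gT] dW)
    (V : vectType R[i]) (dV : {dot V for conjC})
    (theta : unitary_rep K dV) :
  let HomG := hom_rep sigma (ind_rep theta) in
  let HomK := hom_rep (res_rep (subsetT K) sigma) theta in
  [/\ forall T, T \in HomG -> wedge T \in HomK,
      [/\ forall a, {in HomG &, forall T1 T2,
            wedge (a *: T1 + T2) = a *: wedge T1 + wedge T2},
          {in HomG &, forall T1 T2,
            hs_dot dW dV (wedge T1) (wedge T2)
            = hs_dot dW (ind_dot theta) T1 T2},
          {in HomG &, injective wedge}
        & forall L, L \in HomK -> exists2 T, T \in HomG & wedge T = L],
      [/\ forall L, L \in HomK -> vee theta sigma L \in HomG,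
          {in HomG, cancel wedge (vee theta sigma)}
        & {in HomK, cancel (vee theta sigma) wedge}]
    & {in HomG, forall T,
        circ (adjoint dW (ind_dot theta) T) = adjoint dW dV (wedge T)}].
Proof.
split.
- exact: wedge_hom.
- split.
  + by move=> a T1 T2 _ _; exact: wedge_is_linear.
  + exact: wedge_isometry.
  + exact: can_in_inj (@wedgeK _ _ _ _ _ _ _ _ _).
  + by move=> L LK; exists (vee theta sigma L); [exact: vee_hom | exact: veeK].
- by split; [exact: vee_hom | exact: wedgeK | exact: veeK].
- by move=> T _; exact: circ_adjoint.
Qed.
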